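(* Let $p$ be a prime and let $x\in\mathbb{T}=\mathbb{R}/\mathbb{Z}$ satisfy $m_p(x)>0$. Then $$\mathcal{H}^{h_1}\bigl(F_p(x)\bigr)>0.$$ More generally, if $h$ is a dimension function such that $\liminf_{r\to 0}h(r)\log(1/r)>0$, then $\mathcal{H}^{h}(F_p(x))>0$. If $h$ is a dimension function such that $h(r)\log(1/r)\to\infty$ as $r\to0$, then $\mathcal{H}^{h}(F_p(x))=\infty$.
   Context: $\mathbb{T}=\mathbb{R}/\mathbb{Z}$ is the circle with its usual metric. For real $t$, $\|t\|$ is the distance from $t$ to $\mathbb{Z}$; for a positive integer $q$ and $x\in\mathbb{T}$, $\|qx\|$ is well defined. $|\cdot|_p$ is the $p$-adic absolute value with $|p|_p=p^{-1}$. Put $m_p(x)=\liminf_{q\to\infty}q\,|q|_p\,\|qx\|$, with $q$ ranging over positive integers. Let $T_p:\mathbb{T}\to\mathbb{T}$, $T_p(y)=py \pmod 1$, and let $F_p(x)=\overline{\{T_p^k x:k\ge 0\}}$ (closure in $\mathbb{T}$). A dimension function (gauge function) is a continuous non-decreasing function $h:[0,\infty)\to[0,\infty)$ with $h(0)=0$ and $h(r)>0$ for $r>0$. For a subset $E$ of a metric space and $\delta>0$, $\mathcal{H}^h_\delta(E)=\inf\{\sum_i h(\operatorname{diam}U_i): E\subseteq\bigcup_i U_i,\ \operatorname{diam}U_i\le\delta\}$, the infimum being over countable covers, and $\mathcal{H}^h(E)=\lim_{\delta\to0}\mathcal{H}^h_\delta(E)$. The gauge $h_1$ is $h_1(r)=1/\log(1/r)$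 for $0<r<e^{-1}$, $h_1(0)=0$, extended away from zero in any continuous non-decreasing way. *)

(* Defs.v *)
From HB Require Import structures.
From mathcomp Require Import all_boot all_order all_algebra.
From mathcomp Require Import all_classical all_reals all_analysis.

Set Implicit Arguments.
Unset Strict Implicit.
Unset Printing Implicit Defensive.

Import Order.TTheory GRing.Theory Num.Theory.
Import numFieldNormedType.Exports.

Local Open Scope classical_set_scope.
Local Open Scope ring_scope.

Section dist_int.
Context {R : realType}.
Implicit Types s t : R.

Definition dist_int t : R := inf [set `|t - m%:~R| | m in [set: int]].

Lemma dist_int_le t (m : int) : dist_int t <= `|t - m%:~R|.
Proof.
apply: ge_inf; last by exists m.
by exists 0 => _ [k _ <-].
Qed.

Lemma le_dist_int t (c : R) :
  (forall m : int, c <= `|t - m%:~R|) -> c <= dist_int t.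
Proof.
move=> h; apply: lb_le_inf; first by exists `|t - 0%:~R|, 0.
by move=> _ [m _ <-].
Qed.

Lemma dist_int_ge0 t : 0 <= dist_int t.
Proof. exact: le_dist_int. Qed.

Lemma dist_int_attained t : exists m : int, dist_int t = `|t - m%:~R|.
Proof.
pose k := Num.floor t.
have kt : k%:~R <= t := floor_le_tmp t.
have tk : t < (k + 1)%:~R := floorD1_gt t.
have kd (m : int) : m <= k -> `|t - k%:~R| <= `|t - m%:~R|.
  move=> mk; have mkR : m%:~R <= k%:~R :> R by rewrite ler_int.
  by rewrite !ger0_norm ?subr_ge0 ?lerB// (le_trans mkR).
have kd1 (m : int) : k < m -> `|t - (k + 1)%:~R| <= `|t - m%:~R|.
  rewrite -lezD1 => mk; have mkR : (k + 1)%:~R <= m%:~R :> R by rewrite ler_int.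
  have tm : t <= m%:~R by rewrite (le_trans (ltW tk)).
  by rewrite !ler0_norm ?subr_le0 ?(ltW tk)// lerN2 lerB.
have [le_k|lt_k] := leP `|t - k%:~R| `|t - (k + 1)%:~R|.
- exists k; apply/eqP; rewrite eq_le dist_int_le /=; apply: le_dist_int => m.
  by have [/kd//|/kd1] := leP m k; apply: le_trans.
- exists (k + 1); apply/eqP; rewrite eq_le dist_int_le /=.
  apply: le_dist_int => m.
  by have [/kd|/kd1//] := leP m k; apply: le_trans; exact: ltW.
Qed.

Lemma dist_int0 : dist_int 0 = 0.
Proof.
apply/eqP; rewrite eq_le dist_int_ge0 andbT.
by rewrite (le_trans (dist_int_le 0 0))// subrr normr0.
Qed.

Lemma dist_int_eq0 t : dist_int t = 0 -> t \is a Num.int.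
Proof.
have [m ->] := dist_int_attained t.
by move/normr0_eq0/eqP; rewrite subr_eq0 => /eqP ->; exact: intr_int.
Qed.

Lemma dist_intN t : dist_int (- t) = dist_int t.
Proof.
have le s : dist_int (- s) <= dist_int s.
  have [m ->] := dist_int_attained s.
  by rewrite (le_trans (dist_int_le _ (- m)))// mulrNz -opprD normrN.
by apply/eqP; rewrite eq_le le /= -{1}(opprK t) le.
Qed.

Lemma dist_intD s t : dist_int (s + t) <= dist_int s + dist_int t.
Proof.
have [m ->] := dist_int_attained s; have [n ->] := dist_int_attained t.
rewrite (le_trans (dist_int_le _ (m + n)))//.
by rewrite intrD opprD addrACA ler_normD.
Qed.

Lemma dist_int_mod s t : s - t \is a Num.int -> dist_int s = dist_int t.
Proof.
have le a b : a - b \is a Num.int -> dist_int a <= dist_int b.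
  move=> /intrP[k abk]; have [m ->] := dist_int_attained b.
  rewrite (le_trans (dist_int_le _ (m + k)))//.
  rewrite -[a](subrK b) abk intrD opprD [- m%:~R - _]addrC addrACA.
  by rewrite subrr add0r.
by move=> st; apply/eqP; rewrite eq_le !le// -opprB rpredN.
Qed.

End dist_int.

Section circle.
Variable R : realType.

Definition int_subgroup : {pred R} := fun t => t \is a Num.int.

Lemma int_subgroup_zmod_closed : zmod_closed int_subgroup.
Proof.
split=> [|s t]; rewrite /int_subgroup !unfold_in; first exact: rpred0.
exact: rpredB.
Qed.

HB.instance Definition _ :=
  GRing.isZmodClosed.Build R int_subgroup int_subgroup_zmod_closed.

Definition circle : Type := Quotient.quot int_subgroup.
HB.instance Definition _ := GRing.Zmodule.on circle.
HB.instance Definition _ := Quotient.on circle.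
HB.instance Definition _ := isPointed.Build circle 0.

Definition circle_norm (x : circle) : R := dist_int (repr x).

(* The choice of the representative of x is irrelevant. *)
Lemma circle_norm_pi (t : R) : circle_norm (\pi_circle t)%qT = dist_int t.
Proof.
apply: dist_int_mod; rewrite -[_ \is a _]/(_ \in int_subgroup).
rewrite (Quotient.idealrBE int_subgroup).
exact/eqP/(@reprK _ circle).
Qed.

Definition circle_dist (x y : circle) : R := circle_norm (x - y).

Lemma circle_piD (s t : R) :
  (\pi_circle (s + t) = \pi_circle s + \pi_circle t)%qT.
Proof. exact: Quotient.pi_add. Qed.

Lemma circle_piN (s : R) : (\pi_circle (- s) = - \pi_circle s)%qT.
Proof. exact: Quotient.pi_opp. Qed.

Lemma circle_dist_pi (s t : R) :
  circle_dist (\pi_circle s)%qT (\pi_circle t)%qT = dist_int (s - t).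
Proof. by rewrite -circle_norm_pi circle_piD circle_piN. Qed.

Lemma circle_distxx x : circle_dist x x = 0.
Proof. by rewrite -[x]reprK circle_dist_pi subrr dist_int0. Qed.

Lemma circle_dist_eq0 x y : circle_dist x y = 0 -> x = y.
Proof.
rewrite -[x]reprK -[y]reprK circle_dist_pi => /dist_int_eq0.
rewrite -[_ \is a _]/(_ \in int_subgroup).
by rewrite (Quotient.idealrBE int_subgroup) => /eqP.
Qed.

Lemma circle_distC x y : circle_dist x y = circle_dist y x.
Proof. by rewrite -[x]reprK -[y]reprK !circle_dist_pi -dist_intN opprB. Qed.

Lemma circle_dist_triangle y x z :
  circle_dist x z <= circle_dist x y + circle_dist y z.
Proof.
rewrite -[x]reprK -[y]reprK -[z]reprK !circle_dist_pi.
by rewrite (le_trans _ (dist_intD _ _))// addrA subrK.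
Qed.

HB.instance Definition _ := isMetric.Build R circle
  circle_distxx circle_dist_eq0 circle_distC circle_dist_triangle.

End circle.

Section mp.
Context {R : realType}.

Definition padic_abs (p q : nat) : R :=
  if q == 0%N then 0 else p%:R ^- logn p q.

(* The term of index q = 0 does not affect the lower limit. *)
Definition mp (p : nat) (x : circle R) : \bar R :=
  limn_einf (fun q => (q%:R * padic_abs p q * circle_norm (x *+ q))%:E).

Definition Tp (p : nat) (y : circle R) : circle R := y *+ p.

Definition Fp (p : nat) (x : circle R) : set (circle R) :=
  closure [set iter k (Tp p) x | k in [set: nat]].

End mp.

Section hausdorff.
Context {R : realType}.

(* Only the values of h on [0, +oo[ are relevant. *)
Record dimension_function (h : R -> R) : Prop := DimensionFunction {
  dimf_continuous : {within `[0, +oo[, continuous h} ;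
  dimf_nondecreasing : forall r s, 0 <= r -> r <= s -> h r <= h s ;
  dimf0 : h 0 = 0 ;
  dimf_gt0 : forall r, 0 < r -> 0 < h r }.

Context {M : metricType R}.
Implicit Types (U E : set M) (h : R -> R) (d : R).

(* Adding 0 only serves to give the empty set the diameter 0. *)
Definition diam U : \bar R :=
  ereal_sup (0%E |` [set (mdist xy.1 xy.2)%:E | xy in U `*` U]).

(* Finite covers are obtained by padding with empty sets, for which
   h (diam set0) = h 0 = 0. *)
Definition hausdorff_pre h d E : \bar R :=
  ereal_inf [set (\sum_(0 <= i <oo) (h (fine (diam (U i))))%:E)%E
            | U in [set U : (set M)^nat |
                E `<=` \bigcup_i U i /\ forall i, (diam (U i) <= d%:E)%E]].

Definition hausdorff h E : \bar R :=
  lim (hausdorff_pre h d E @[d --> 0^'+]).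

Lemma hausdorff_pre_nonincreasing h E d d' :
  d <= d' -> (hausdorff_pre h d' E <= hausdorff_pre h d E)%E.
Proof.
move=> dd'; apply: ereal_inf_le_tmp => _ [U [EU Ud] <-].
by exists U => //; split=> // i; rewrite (le_trans (Ud i))// lee_fin.
Qed.

Lemma hausdorff_is_cvg h E : cvg (hausdorff_pre h d E @[d --> 0^'+]).
Proof.
apply: nonincreasing_at_right_is_cvge; near=> e => d d' _ _.
exact: hausdorff_pre_nonincreasing.
Unshelve. all: by end_near. Qed.

End hausdorff.

(* Main.v *)
Require Import Defs.
From mathcomp Require Import all_boot all_order all_algebra.
From mathcomp Require Import all_classical all_reals all_analysis.
From mathcomp Require Import finmap lra.

Set Implicit Arguments.
Unset Strict Implicit.
Unset Printing Implicit Defensive.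

Import Order.TTheory GRing.Theory Num.Theory.
Import numFieldNormedType.Exports.

Local Open Scope classical_set_scope.
Local Open Scope ring_scope.

(** The orbit of x under multiplication by p cannot return quickly to a small
    ball, so it visits a ball of radius r with frequency O(1 / log(1/r)); a
    cover of the orbit closure must therefore have
    sum of 1 / log(1 / diam U_i) bounded below.

    In detail, the liminf hypothesis gives c > 0 with
    c <= q |q|_p ||q x|| for all large q. Take q = p^k (p^j - 1), k large: then
    q |q|_p = p^j - 1, and ||q x|| is the distance between the orbit points
    p^k x and p^(k+j) x. These points are thus at distance at least c p^(-j)
    ([mp_gt0_exp_separated]). If both lie in a ball of radius r, then
    c p^(-j) < 2 r, so j exceeds log(c / 2r) / log p ([return_time_gt]).

    Consequently, among the first N points of the orbit, at most
    N log p / log(c / 2r) + 1 lie in the ball. The orbit closure is compact,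
    so finitely many members of a cover by balls of radii r_i contain every
    orbit point; summing the counts, dividing by N and letting N tend to
    infinity yields 1 <= sum of log p / log(c / 2 r_i)
    ([sum_inv_gap_ge1], [ball_cover_sum_ge1]). The frequencies of visits
    play the part of the measure in the mass distribution principle.

    Arbitrary covering sets are replaced by balls: a set of positive diameter r
    by a ball of radius 2r, and a set with at most one point by a ball so small
    that all these balls together contribute at most 1/2. What remains is
    1 / (4 log p) <= sum of 1 / log(1 / diam U_i) over the sets of positive
    diameter ([diam_cover_sum_ge]). If h(r) log(1/r) >= a near 0, this bounds
    H^h from below by a / (4 log p) ([hausdorff_ge]); the three assertions are
    the cases a = 1, some a > 0, and all a > 0. *)

(** * Sets of integers with large gaps *)

Lemma card_spaced (N g : nat) (A : {set 'I_N}) : (0 < g)%N ->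
  (forall i j, i \in A -> j \in A -> (i < j)%N -> (g <= j - i)%N) ->
  (#|A| <= (N %/ g).+1)%N.
Proof.
move=> g0 gap.
pose f (i : 'I_N) : 'I_(N %/ g).+1 := inord (i %/ g).
have fE (i : 'I_N) : f i = (i %/ g)%N :> nat.
  by rewrite inordK// ltnS leq_div2r// ltnW.
rewrite -[leqRHS]card_ord -(@card_in_imset _ _ f A) ?max_card// => i j iA jA.
move/(congr1 val); rewrite /= !fE => ij; apply/val_inj => /=.
(* two members of A in the same block of length g would be too close *)
wlog ltij : i j iA jA ij / (i < j)%N.
  by move=> wl; case: (ltngtP i j) => // h; [|apply/esym]; apply: wl.
have := gap _ _ iA jA ltij.
by rewrite {1}(divn_eq j g) {1}(divn_eq i g) ij subnDl leqNgt;
  rewrite (leq_ltn_trans (leq_subr _ _))// ltn_pmod.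
Qed.

(** Counting in an initial segment of length N: a set with gaps exceeding L
    has at most N / L + 1 members there. Finitely many such sets that cover the
    natural numbers satisfy N <= N * S + n, where S is the sum of the inverse
    gaps, and S < 1 is absurd for large N. *)
Lemma sum_inv_gap_ge1 (R : realType) (n : nat) (A : nat -> set nat)
    (L : nat -> R) :
  (forall i, (i < n)%N -> 0 < L i) ->
  (forall i k j, (0 < j)%N -> A i k -> A i (k + j)%N -> L i < j%:R) ->
  (forall k, exists2 i, (i < n)%N & A i k) ->
  1 <= \sum_(i < n) (L i)^-1.
Proof.
move=> L0 gap cov; set S := \sum_(i < n) _.
have count N : N%:R <= N%:R * S + n%:R.
  pose B (i : 'I_n) : {set 'I_N} := finset (fun k : 'I_N => `[< A i k >]).
  have NB : (N <= \sum_(i < n) #|B i|)%N.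
    under eq_bigr do rewrite -sum1_card big_mkcond.
    rewrite exchange_big -{1}[N]card_ord -sum1_card; apply: leq_sum => k _.
    have [i lin Aik] := cov k; rewrite (bigD1 (Ordinal lin))//= inE.
    by rewrite (introT (asboolP _) Aik).
  have cB (i : 'I_n) : #|B i|%:R <= N%:R * (L i)^-1 + 1.
    have Li := L0 _ (ltn_ord i); set g := (Num.truncn (L i)).+1.
    have : (#|B i| <= (N %/ g).+1)%N.
      have AB k : k \in B i -> A i k by rewrite inE => Ak; exact: asboolW Ak.
      apply: card_spaced => // k l /AB Ak /AB Al kl.
      have Llk : L i < (l - k)%N%:R.
        apply: (gap i k) => //; first by rewrite subn_gt0.
        by rewrite subnKC// ltnW.
      by rewrite /g -(ltr_nat R) (le_lt_trans _ Llk)// truncn_le ltW.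
    rewrite -(ler_nat R) -natr1 => /le_trans; apply; rewrite lerD2r.
    rewrite ler_pdivlMr//; apply: le_trans (_ : (N %/ g)%:R * g%:R <= _).
      by rewrite ler_wpM2l// ltW// truncnS_gt.
    by rewrite -natrM ler_nat leq_trunc_div.
  have := NB; rewrite -(ler_nat R) natr_sum => /le_trans; apply.
  apply: le_trans (ler_sum _ (fun i _ => cB i)) _.
  by rewrite big_split/= -mulr_sumr sumr_const card_ord.
rewrite leNgt; apply/negP => S1.
(* the inequality N <= N * S + n fails as soon as N > n / (1 - S) *)
have := count (Num.truncn (n%:R / (1 - S))).+1; set N := _.+1.
have : n%:R / (1 - S) < N%:R by exact: truncnS_gt.
by rewrite ltr_pdivrMr ?subr_gt0// mulrBr mulr1; lra.
Qed.

(** * Exponentially separated sequences *)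

Lemma open_metric_ball (R : realType) (M : metricType R) (u : M) (r : R) :
  open (ball u r).
Proof.
rewrite openE => y; rewrite ballEmdist/= => uy; apply/nbhs_ballP.
exists (r - mdist u y) => /=; first by rewrite subr_gt0.
move=> t; rewrite !ballEmdist/= => yt.
by rewrite (le_lt_trans (metric_triangle u y t))// -ltrBrDl.
Qed.

(** The separation is allowed to decay with the time difference j, so the
    sequence may accumulate, but only after a time logarithmic in the scale. *)
Definition exp_separated (R : realType) (M : metricType R) (b c : R)
    (z : nat -> M) :=
  forall k j, (0 < j)%N -> c * b ^- j <= mdist (z k) (z (k + j)%N).

(** Two points in a ball of radius r are less than 2r apart, whereas after j
    steps they are at least c / b^j apart. *)
Lemma return_time_gt (R : realType) (M : metricType R) (b c r : R)
    (z : nat -> M) (u : M) k j :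
  1 < b -> 0 < c -> 0 < r -> exp_separated b c z -> (0 < j)%N ->
  ball u r (z k) -> ball u r (z (k + j)%N) ->
  ln (c / (2 * r)) / ln b < j%:R.
Proof.
move=> b1 c0 r0 sep j0; rewrite !ballEmdist/= => zk zkj.
have b0 : 0 < b by lra.
have bj : 0 < b ^+ j by rewrite exprn_gt0.
have cb : c * b ^- j < 2 * r.
  apply: le_lt_trans (sep k j j0) _.
  apply: le_lt_trans (metric_triangle _ u _) _.
  by rewrite (metric_sym (z k)); lra.
have lnb : 0 < ln b by exact: ln_gt0.
rewrite ltr_pdivrMr// (mulr_natl _ j) -lnXn// ltr_ln ?posrE//; last first.
  by rewrite divr_gt0// mulr_gt0.
rewrite ltr_pdivrMr ?mulr_gt0//.
by move: cb; rewrite ltr_pdivrMr// mulrC.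
Qed.

(** Compactness leaves finitely many balls, and the return times bound the gaps
    of the set of indices at which the sequence visits each of them. *)
Lemma ball_cover_sum_ge1 (R : realType) (M : metricType R) (F : set M)
    (b c : R) (z : nat -> M) (u : nat -> M) (r : nat -> R) :
  1 < b -> exp_separated b c z -> cover_compact F -> (forall k, F (z k)) ->
  (forall i, 0 < r i /\ 2 * r i < c) -> F `<=` \bigcup_i ball (u i) (r i) ->
  exists n, 1 <= \sum_(i < n) ln b / ln (c / (2 * r i)).
Proof.
move=> b1 sep Fco Fz rc Fcov.
have [D _ FD] := Fco nat setT (fun i => ball (u i) (r i))
  (fun i _ => open_metric_ball _ _) Fcov.
have [n Dn] : exists n, forall i : nat, i \in D -> (i < n)%N.
  exists (\max_(i <- D) i).+1 => i iD.
  by rewrite ltnS; exact: leq_bigmax_seq.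
exists n; have lnb : 0 < ln b by exact: ln_gt0.
have lnr i : 0 < ln (c / (2 * r i)).
  have [r0 rci] := rc i; apply: ln_gt0.
  by rewrite ltr_pdivlMr ?mulr_gt0// mul1r.
have c0 : 0 < c by have [] := rc 0; lra.
rewrite (_ : \sum_(i < n) _ = \sum_(i < n) (ln (c / (2 * r i)) / ln b)^-1).
  apply: (@sum_inv_gap_ge1 _ _ (fun i k => ball (u i) (r i) (z k))
    (fun i => ln (c / (2 * r i)) / ln b)).
  - by move=> i _; rewrite divr_gt0.
  - by move=> i k j j0; apply: return_time_gt => //; have [] := rc i.
  - by move=> k; have [i /Dn ? ?] := FD _ (Fz k); exists i.
by apply: eq_bigr => i _; rewrite invf_div.
Qed.

(** * Lower bounds for Hausdorff measures *)

Lemma mdist_le_diam (R : realType) (M : metricType R) (U : set M) (d : R) x y :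
  (diam U <= d%:E)%E -> U x -> U y -> mdist x y <= fine (diam U).
Proof.
move=> Ud Ux Uy.
have xyU : ((mdist x y)%:E <= diam U)%E.
  by apply: ereal_sup_ubound; right; exists (x, y).
have U0 : (0 <= diam U)%E by apply: ereal_sup_ubound; left.
by rewrite -lee_fin fineK// ge0_fin_numE// (le_lt_trans Ud)// ltry.
Qed.

Lemma fine_diam_itv (R : realType) (M : metricType R) (U : set M) (d : R) :
  (diam U <= d%:E)%E -> 0 <= fine (diam U) <= d.
Proof.
move=> Ud; have U0 : (0 <= diam U)%E by apply: ereal_sup_ubound; left.
have Ufin : diam U \is a fin_num.
  by rewrite ge0_fin_numE// (le_lt_trans Ud)// ltry.
by rewrite fine_ge0//= -lee_fin fineK.
Qed.

(** The constants c and 4 cost only a factor 2 in the logarithm at small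
    scales, since 16 r <= c^2 says that 1 / r <= (c / 4r)^2. *)
Lemma ln_inv_le_double (R : realType) (c r : R) : 0 < c -> 0 < r ->
  16 * r <= c ^+ 2 -> ln (1 / r) <= 2 * ln (c / (4 * r)).
Proof.
move=> c0 r0 rc; have r40 : 0 < 4 * r by lra.
rewrite mulr_natl -lnXn ?divr_gt0// ler_ln ?posrE ?exprn_gt0 ?divr_gt0//.
rewrite expr_div_n ler_pdivlMr ?exprn_gt0// exprMn.
by rewrite mul1r [r ^+ 2]expr2 mulrCA mulKf ?gt_eqF//; lra.
Qed.

Lemma sum_half_pow (R : realType) n :
  \sum_(i < n) (2 ^+ i.+2)^-1 = 2^-1 - (2 ^+ n.+1)^-1 :> R.
Proof.
elim: n => [|n IH]; first by rewrite big_ord0 expr1 subrr.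
rewrite big_ord_recr/= IH [2 ^+ n.+2]exprS invfM; lra.
Qed.

(** Sets of diameter 0 drop out of the sum. They still have to be covered by
    balls of positive radius, so the radii chosen for them make the i-th term of
    the sum over balls equal to 2^-(i+2); these terms add up to at most 1/2,
    and the sets of positive diameter account for the other half. *)
Lemma diam_cover_sum_ge (R : realType) (M : metricType R) (F : set M)
    (b c d : R) (z : nat -> M) (U : nat -> set M) :
  1 < b -> 0 < c -> exp_separated b c z ->
  cover_compact F -> (forall k, F (z k)) ->
  d < 1 -> 16 * d <= c ^+ 2 ->
  F `<=` \bigcup_i U i -> (forall i, (diam (U i) <= d%:E)%E) ->
  exists n, (4 * ln b)^-1 <=
    \sum_(i < n | 0 < fine (diam (U i))) (ln (1 / fine (diam (U i))))^-1.
Proof.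
move=> b1 c0 sep Fco Fz d1 dc FU Ud; pose r i := fine (diam (U i)).
have b0 : 0 < b by lra.
have lnb : 0 < ln b by exact: ln_gt0.
have rd i : 0 <= r i <= d by exact: fine_diam_itv.
have bm0 i : 0 < b ^+ (2 ^ i.+2) by rewrite exprn_gt0.
(* the exponent 2^(i+2) makes ln (c / (2 * rho i)) = 2^(i+2) * ln b *)
pose rho i := if 0 < r i then 2 * r i else c / (2 * b ^+ (2 ^ i.+2)).
have rhoE i : r i <= 0 -> 2 * rho i = c / b ^+ (2 ^ i.+2).
  by move=> ri; rewrite /rho ltNge ri/= invfM mulrCA mulVKf.
have rho_gt i : r i < rho i.
  rewrite /rho; case: ifPn => [|]; first lra.
  rewrite -leNgt => ri; apply: le_lt_trans ri _.
  by rewrite divr_gt0// mulr_gt0.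
have rho_itv i : 0 < rho i /\ 2 * rho i < c.
  split; first by have := rho_gt i; have := rd i; lra.
  have [ri|ri] := ltP 0 (r i); last first.
    rewrite rhoE// ltr_pdivrMr// ltr_pMr//.
    by rewrite exprn_egt1// -lt0n expn_gt0.
  rewrite /rho ri; have := rd i; have ric : 16 * r i <= c ^+ 2.
    by have := rd i; lra.
  by move=> ?; nra.
(* for an empty U i any centre will do *)
pose u i := xget (z 0) (U i).
have Fball : F `<=` \bigcup_i ball (u i) (rho i).
  move=> y /FU[i _ Uy]; exists i => //; rewrite ballEmdist/=.
  apply: le_lt_trans (rho_gt i); apply: (mdist_le_diam (Ud i) _ Uy).
  exact: xgetI Uy.
have [n sum1] := ball_cover_sum_ge1 b1 sep Fco Fz rho_itv Fball.
exists n; set S := \sum_(i < n | _) _.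
have term (i : 'I_n) : ln b / ln (c / (2 * rho i)) <=
    2 * ln b * (if 0 < r i then (ln (1 / r i))^-1 else 0) + (2 ^+ i.+2)^-1.
  have i2 : 0 < (2 ^+ i.+2)^-1 :> R by rewrite invr_gt0 exprn_gt0.
  have [ri|ri] := ltP 0 (r i).
    have lnr : 0 < ln (1 / r i).
      by apply: ln_gt0; rewrite ltr_pdivlMr// mul1r; have := rd i; lra.
    have := @ln_inv_le_double _ c (r i) c0 ri.
    have -> : 2 * rho i = 4 * r i by rewrite /rho ri; lra.
    move=> H; have {}H : ln (1 / r i) <= 2 * ln (c / (4 * r i)).
      by apply: H; have := rd i; lra.
    apply: le_trans (_ : 2 * ln b * (ln (1 / r i))^-1 <= _); last lra.
    rewrite ler_pdivrMr; last lra.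
    by rewrite mulrAC ler_pdivlMr//; nra.
  rewrite mulr0 add0r rhoE// invf_div mulrCA divff ?gt_eqF// mulr1.
  rewrite lnXn// -[ln b *+ _]mulr_natl invfM mulrCA divff ?gt_eqF// mulr1.
  by rewrite natrX.
have := le_trans sum1 (ler_sum _ (fun i _ => term i)).
rewrite big_split/= -mulr_sumr -big_mkcond/= sum_half_pow -/S => H.
have n2 : 0 < (2 ^+ n.+1)^-1 :> R by rewrite invr_gt0 exprn_gt0.
have : 1 <= S * (4 * ln b) by move: H; set V := S; nra.
by rewrite -ler_pdivrMr ?mul1r// mulr_gt0.
Qed.

Lemma hausdorff_pre_ge (R : realType) (M : metricType R) (F : set M)
    (b c d a : R) (z : nat -> M) (h : R -> R) :
  1 < b -> 0 < c -> exp_separated b c z ->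
  cover_compact F -> (forall k, F (z k)) ->
  d < 1 -> 16 * d <= c ^+ 2 ->
  (forall r : R, 0 <= r -> 0 <= h r) ->
  0 <= a -> (forall r : R, 0 < r <= d -> a <= h r * ln (1 / r)) ->
  ((a / (4 * ln b))%:E <= hausdorff_pre h d F)%E.
Proof.
move=> b1 c0 sep Fco Fz d1 dc h0 a0 ha.
apply: le_ereal_inf_tmp => _ [U [FU Ud] <-].
have [n sumn] := diam_cover_sum_ge b1 c0 sep Fco Fz d1 dc FU Ud.
have hU i : 0 <= h (fine (diam (U i))).
  by apply: h0; have /andP[] := fine_diam_itv (Ud i).
apply: (@le_trans _ _ (\sum_(0 <= i < n) (h (fine (diam (U i))))%:E)%E);
  last first.
  by apply: nneseries_lim_ge => i _ _; rewrite lee_fin.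
rewrite sumEFin lee_fin big_mkord.
apply: le_trans (ler_wpM2l a0 sumn) _.
rewrite mulr_sumr big_mkcond/=; apply: ler_sum => i _; case: ifPn => // Ui.
have /andP[_ Uid] := fine_diam_itv (Ud i).
rewrite ler_pdivrMr; first by apply: ha; rewrite Ui.
by apply: ln_gt0; rewrite ltr_pdivlMr// mul1r; lra.
Qed.

(** The bound is linear in a with a slope that does not depend on h, so that it
    also yields an infinite measure when a is arbitrary. *)
Lemma hausdorff_ge (R : realType) (M : metricType R) (F : set M)
    (b c a : R) (z : nat -> M) (h : R -> R) :
  1 < b -> 0 < c -> exp_separated b c z ->
  cover_compact F -> (forall k, F (z k)) ->
  (forall r : R, 0 <= r -> 0 <= h r) ->
  0 <= a -> (\forall r \near 0^'+, a <= h r * ln (1 / r)) ->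
  ((a / (4 * ln b))%:E <= hausdorff h F)%E.
Proof.
move=> b1 c0 sep Fco Fz h0 a0 /nbhs_ballP[/= e e0 he].
have ha r : 0 < r < e -> a <= h r * ln (1 / r).
  move=> /andP[r0 re]; apply: he => //.
  by rewrite /ball/= sub0r normrN gtr0_norm.
apply: lime_ge; first exact: hausdorff_is_cvg.
near=> d; have d0 : 0 < d by [].
apply: (hausdorff_pre_ge b1 c0 sep Fco Fz) => //.
- rewrite mulrC -ler_pdivlMr//; near: d; apply: nbhs_right_le.
  by rewrite divr_gt0// exprn_gt0.
- move=> r /andP[r0 rd]; apply: ha; rewrite r0 (le_lt_trans rd)//.
Unshelve. all: by end_near. Qed.

(** * The orbit of x and its closure *)

Lemma limf_einf_gt0 (T : choiceType) (X : filteredType T) (R : realType)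
    (f : X -> R) (F : set_system X) : Filter F ->
  (0 < limf_einf (fun t => (f t)%:E) F)%E ->
  exists2 c, 0 < c & \forall t \near F, c <= f t.
Proof.
move=> FF; rewrite limf_einfE => /ereal_sup_gt[_ [V FV <-] V0].
have [c c0 cV] : exists2 c : R, 0 < c &
    (c%:E <= ereal_inf ((fun t => (f t)%:E) @` V))%E.
  case: (ereal_inf _) V0 => [c c0| _|//]; first by exists c.
  by exists 1; rewrite ?leey.
exists c => //; apply: filterS FV => t Vt.
by rewrite -lee_fin (le_trans cV)//; apply: ereal_inf_lbound; exists t.
Qed.

Lemma iter_Tp (R : realType) (p k : nat) (x : circle R) :
  iter k (Tp p) x = x *+ p ^ k.
Proof.
elim: k => [|k IH]; first by rewrite expn0 mulr1n.
by rewrite iterS IH /Tp -mulrnA expnSr.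
Qed.

(** The factor p^j - 1 is prime to p, as j > 0. *)
Lemma padic_abs_expB1 (R : realType) (p k j : nat) : prime p -> (0 < j)%N ->
  padic_abs p (p ^ k * (p ^ j - 1)) = p%:R ^- k :> R.
Proof.
move=> pp j0; have p0 := prime_gt0 pp.
have q0 : (0 < p ^ j - 1)%N.
  by rewrite subn_gt0 -{1}(expn0 p) ltn_exp2l ?prime_gt1.
have pq : logn p (p ^ j - 1) = 0%N.
  apply/eqP; rewrite -leqn0 leqNgt logn_gt0 mem_primes pp q0/=.
  rewrite dvdn_subr ?expn_gt0 ?p0//; last by rewrite dvdn_exp.
  by rewrite dvdn1; apply/negP => /eqP p1; rewrite p1 in pp.
rewrite /padic_abs muln_eq0 !gtn_eqF ?expn_gt0 ?p0//=.
by rewrite lognM ?expn_gt0 ?p0// pq addn0 pfactorK.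
Qed.

(** For q = p^k (p^j - 1) the p-adic factor cancels p^k, so the lower bound on
    ||q x|| depends on j alone. The liminf controls only large q, which is
    ensured by starting the orbit at time K. *)
Lemma mp_gt0_exp_separated (R : realType) (p : nat) (x : circle R) :
  prime p -> (0 < mp p x)%E ->
  exists (c : R) (K : nat), 0 < c /\
    exp_separated p%:R c (fun k => x *+ p ^ (K + k)).
Proof.
move=> pp /limf_einf_gt0[c c0 [K _ HK]]; exists c, K; split=> // k j j0.
have p0 : (0 : R) < p%:R by rewrite ltr0n prime_gt0.
set q := (p ^ (K + k) * (p ^ j - 1))%N.
have j1 : (0 < p ^ j - 1)%N.
  by rewrite subn_gt0 -{1}(expn0 p) ltn_exp2l ?prime_gt1.
have Kq : (K <= q)%N.
  rewrite (leq_trans (ltnW (ltn_expl K (prime_gt1 pp))))//.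
  rewrite (@leq_trans (p ^ (K + k))%N) ?leq_pmulr//.
  by rewrite leq_exp2l ?leq_addr ?prime_gt1.
have := HK q Kq; rewrite /= {1 2}/q padic_abs_expB1// natrM natrX.
rewrite (mulrC (p%:R ^+ _)) mulfK ?gt_eqF ?exprn_gt0//.
have -> : mdist (x *+ p ^ (K + k)) (x *+ p ^ (K + (k + j))) =
    circle_norm (x *+ q).
  rewrite metric_sym; rewrite -[LHS]/(circle_dist _ _) /circle_dist.
  by rewrite /q mulnBr muln1 -expnD -addnA mulrnBr//
    leq_exp2l ?prime_gt1// addnA leq_addr.
move=> cq; rewrite ler_pdivrMr ?exprn_gt0// mulrC (le_trans cq)//.
by rewrite ler_wpM2r ?dist_int_ge0// -natrX ler_nat leq_subr.
Qed.

Lemma circle_compact (R : realType) : compact [set: circle R].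
Proof.
pose f (t : R) : circle R := (\pi_(circle R) t)%qT.
have cf : continuous f.
  move=> s; apply/cvg_ballP => e e0; near=> t.
  rewrite ballEmdist/= -[mdist _ _]/(circle_dist _ _) circle_dist_pi.
  rewrite (le_lt_trans (dist_int_le _ 0))// subr0.
  near: t; exact: cvgr_dist_lt.
rewrite (_ : [set: circle R] = f @` `[0, 1]).
  apply: continuous_compact; last exact: segment_compact.
  exact: continuous_subspaceT.
apply/seteqP; split=> // y _; exists (repr y - (Num.floor (repr y))%:~R).
  rewrite /= in_itv/= subr_ge0 floor_le_tmp/= lerBlDr addrC.
  by rewrite -[1]/(1%:~R) -intrD ltW// floorD1_gt.
apply: circle_dist_eq0; rewrite -[y in circle_dist _ y]reprK circle_dist_pi.
rewrite (@dist_int_mod _ _ 0) ?dist_int0// subr0 addrAC subrr sub0r rpredN.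
exact: intr_int.
Unshelve. all: by end_near. Qed.

Lemma Fp_hausdorff_ge (R : realType) (p : nat) (x : circle R) :
  prime p -> (0 < mp p x)%E ->
  exists2 kappa : R, 0 < kappa & forall (a : R) (h : R -> R),
    dimension_function h -> 0 <= a ->
    (\forall r \near 0^'+, a <= h r * ln (1 / r)) ->
    ((a * kappa)%:E <= hausdorff h (Fp p x))%E.
Proof.
move=> pp /(mp_gt0_exp_separated pp)[c [K [c0 sep]]].
have p1 : 1 < p%:R :> R by rewrite ltr1n prime_gt1.
exists (4 * ln p%:R)^-1; first by rewrite invr_gt0 mulr_gt0 ?ln_gt0.
move=> a h hdim a0 ha; apply: (hausdorff_ge p1 c0 sep) => //.
- rewrite -compact_cover; apply: subclosed_compact (@circle_compact R) _ => //.
  exact: closed_closure.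
- by move=> k; apply: subset_closure; exists (K + k)%N => //; rewrite iter_Tp.
- move=> r; rewrite le_eqVlt => /predU1P[<-|r0]; first by rewrite dimf0.
  exact/ltW/dimf_gt0.
Qed.

Theorem theorem2p2 (R : realType) (p : nat) (p_prime : prime p)
    (x : circle R) (mpx_gt0 : (0 < mp p x)%E) :
  [/\ forall h1 : R -> R, dimension_function h1 ->
        (forall r, 0 < r < expR (- 1) -> h1 r = 1 / ln (1 / r)) ->
        (0 < hausdorff h1 (Fp p x))%E,
      forall h : R -> R, dimension_function h ->
        (0 < limf_einf (fun r => (h r * ln (1 / r))%:E) (0^'+))%E ->
        (0 < hausdorff h (Fp p x))%E
    & forall h : R -> R, dimension_function h ->
        h r * ln (1 / r) @[r --> 0^'+] --> +oo ->
        hausdorff h (Fp p x) = +oo%E].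
Proof.
have [kappa kappa0 Hge] := Fp_hausdorff_ge p_prime mpx_gt0.
have Hgt0 a h : dimension_function h -> 0 < a ->
    (\forall r \near 0^'+, a <= h r * ln (1 / r)) ->
    (0 < hausdorff h (Fp p x))%E.
  move=> hdim a0 ha; apply: lt_le_trans (Hge a h hdim (ltW a0) ha).
  by rewrite lte_fin mulr_gt0.
split=> h hdim.
- move=> hE; apply: (Hgt0 1) => //; near=> r.
  have r0 : 0 < r by [].
  have re : r < expR (- 1) by near: r; apply: nbhs_right_lt; exact: expR_gt0.
  have lnr : 0 < ln (1 / r).
    have e1 : expR (- 1) < 1 :> R by rewrite expR_lt1 oppr_lt0.
    by apply: ln_gt0; rewrite ltr_pdivlMr// mul1r (lt_trans re).
  by rewrite hE ?r0// mul1r mulVf// gt_eqF.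
- by move=> /limf_einf_gt0[a a0 ha]; exact: (Hgt0 a).
- move=> /cvgryPge hy; apply/eqyP => A A0.
  have := Hge (A / kappa) h hdim (ltW (divr_gt0 A0 kappa0)) (hy _).
  by rewrite divfK// gt_eqF.
Unshelve. all: by end_near. Qed.
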